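(* Let $n$ be a positive integer. Define a double-indexed sequence $F_r(k)$ (integers $r\ge 0$, $k\ge 0$) by $F_r(0)=1$ for all $r$ and, for $k\ge 1$, $$F_r(k)=(2^n-r-k)\,F_r(k-1)+4\,(2^n-2r-1)\,F_{r+1}(k-1).$$ Then the Fermat number $2^{2^n}+1$ satisfies $$2^{2^n}+1=\frac{F_0(2^{n-1})}{(2^n-1)(2^n-2)\cdots(2^{n-1})}.$$
   Context: The denominator is $\prod_{j=1}^{2^{n-1}}(2^n-j)$, the product of all integers from $2^{n-1}$ to $2^n-1$. *)

(* Defs.v *)
From mathcomp Require Import all_boot all_order all_algebra.

Set Implicit Arguments.
Unset Strict Implicit.
Unset Printing Implicit Defensive.

Import GRing.Theory Num.Theory.

Local Open Scope ring_scope.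

(* The values are in int: the coefficients 2^n - r - k and 2^n - 2r - 1
   are negative for large r and k. *)
Fixpoint F (n r k : nat) {struct k} : int :=
  match k with
  | 0%N => 1
  | k'.+1 => (2 ^+ n - r%:Z - k%:Z) * F n r k'
             + 4 * (2 ^+ n - 2 * r%:Z - 1) * F n r.+1 k'
  end.

(* Main.v *)
Require Import Defs.
From mathcomp Require Import all_boot all_order all_algebra.
From mathcomp Require Import zify ring.

(** Write [N = 2 ^ n].  Unfolding the recurrence for [F n r k] sums over lattice
    paths of [k] steps; each step lowers [k] by one and either keeps [r] or raises
    it by one.  A step that keeps [r] has weight [N - (r + k)] and lowers
    [r + k] by one; a step that raises [r] leaves [r + k] alone.  So the weights
    of the steps of each kind do not depend on how the two kinds are interleaved,
    and the paths with [i] raising steps contribute ['C(k, i)] times one product: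
    this is [F_closed_form].

    For [r = 0] and [k = m = N / 2], rewriting the products as factorials
    ([path_weight_lucas]) turns the [i]-th term into [(N - 1) ... m] times
    [2 ^ i * (N / (N - i)) * 'C(N - i, i)].  These rational-looking numbers
    [N / (N - i) * 'C(N - i, i)] are the coefficients of the Lucas polynomials:
    summed against [x ^ i] with [x = - (a * b)] and [a + b = 1] they give
    [a ^ N + b ^ N] ([sum_lucas_coef]).  For [x = 2] the roots are [a = 2] and
    [b = -1], and since [N] is even the sum is [2 ^ N + 1]. *)

Set Implicit Arguments.
Unset Strict Implicit.
Unset Printing Implicit Defensive.

Import GRing.Theory Num.Theory.

Local Open Scope ring_scope.

(** The first product collects, in the order of the path, the weights of the
    [k - i] steps that keep [r]; the second those of the [i] steps that raise it.
    The induction splits off the first step, and Pascal's rule adds up the two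
    cases. *)
Lemma F_closed_form (n r k : nat) :
  F n r k = \sum_(i < k.+1) 'C(k, i)%:R *
    ((\prod_(t < k - i) (2 ^+ n - r%:Z - k%:Z + t%:Z)) *
     (\prod_(s < i) (4 * (2 ^+ n - 2 * (r + s)%N%:Z - 1)))).
Proof.
elim: k r => [|k IHk] r.
  by rewrite big_ord_recl !big_ord0 /= bin0; ring.
set c : int := 2 ^+ n - r%:Z - k.+1%:Z.
pose A j := \prod_(t < j) (c + t%:Z).
pose B j := \prod_(s < j) (4 * (2 ^+ n - 2 * (r + s)%N%:Z - 1)) : int.
have keep : c * F n r k = \sum_(i < k.+1) 'C(k, i)%:R * (A (k.+1 - i)%N * B i).
  rewrite IHk mulr_sumr; apply: eq_bigr => i _.
  rewrite subSn -1?ltnS ?ltn_ord // /A big_ord_recl /= addr0.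
  rewrite mulrCA !mulrA; congr (_ * _ * _ * _).
  by apply: eq_bigr => t _; rewrite /c /bump; lia.
have raise : 4 * (2 ^+ n - 2 * r%:Z - 1) * F n r.+1 k =
    \sum_(i < k.+1) 'C(k, i)%:R * (A (k - i)%N * B i.+1).
  rewrite IHk mulr_sumr; apply: eq_bigr => i _.
  rewrite /B big_ord_recl /= addn0 mulrCA; congr (_ * _).
  rewrite mulrCA; congr (_ * (_ * _)).
    by apply: eq_bigr => t _; rewrite /c; lia.
  by apply: eq_bigr => s _; rewrite /bump; lia.
rewrite /= -/c keep raise big_ord_recl [RHS]big_ord_recl /= !bin0 -addrA.
congr (_ + _).
under [RHS]eq_bigr => i _ do
  rewrite /bump /= add1n subSS binS natrD mulrDl.
rewrite big_split /=; congr (_ + _).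
by rewrite [RHS]big_ord_recr /= bin_small // mul0r addr0.
Qed.

(** The coefficient [N / (N - i) * 'C(N - i, i)] of the [N]-th Lucas polynomial,
    written without division. *)
Definition lucas_coef (N i : nat) : nat :=
  if i is j.+1 then 'C(N - i, i) + 'C(N - j.+2, j) else 1.

Lemma lucas_coef_fact (N i : nat) : (0 < N)%N -> (i.*2 <= N)%N ->
  (lucas_coef N i * (i`! * (N - i.*2)`!) = N * (N - i).-1`!)%N.
Proof.
case: i => [|j] N0 iN.
  by rewrite /= subn0 fact0 !mul1n -{1 2}(prednK N0) factS.
have [q ->] : exists q, N = (q + j.+1.*2)%N by exists (N - j.+1.*2)%N; lia.
rewrite addnK /lucas_coef.
have -> : (q + j.+1.*2 - j.+1 = (q + j).+1)%N by lia.
have -> : (q + j.+1.*2 - j.+2 = q + j)%N by lia.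
have b1 := @bin_fact (q + j).+1 j.+1 ltac:(lia).
have b2 := @bin_fact (q + j) j ltac:(lia).
rewrite subSS addnK in b1; rewrite addnK in b2.
rewrite mulnDl b1 !factS /= -!mulnA [('C(_, _) * _)%N]mulnCA b2 -mulnDl.
by congr (_ * _)%N; lia.
Qed.

(** Diagonal sums of Pascal's triangle, the generalized Fibonacci numbers. *)
Definition fib_sum (R : comNzRingType) (x : R) (n : nat) : R :=
  \sum_(i < n.+1) 'C(n - i, i)%:R * x ^+ i.

Lemma fib_sum_rec (R : comNzRingType) (x : R) (n : nat) :
  fib_sum x n.+2 = fib_sum x n.+1 + x * fib_sum x n.
Proof.
rewrite /fib_sum big_ord_recl [in RHS]big_ord_recl -addrA; congr (_ + _).
rewrite big_ord_recr /= /bump /= add1n subnn bin0n mul0r addr0.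
rewrite mulr_sumr -big_split /=; apply: eq_bigr => i _.
rewrite /bump /= add1n !subSS subSn -1?ltnS ?ltn_ord // binS natrD exprS.
ring.
Qed.

(** With [x = - (a * b)] and [a + b = 1], the numbers [a] and [b] are the roots
    of [X ^ 2 = X + x], the characteristic equation of [fib_sum_rec]; the Lucas
    combination on the left has the initial values of their power sums. *)
Lemma fib_sum_power_sum (R : comNzRingType) (a b : R) (n : nat) : a + b = 1 ->
  fib_sum (- (a * b)) n.+2 + - (a * b) * fib_sum (- (a * b)) n =
  a ^+ n.+2 + b ^+ n.+2.
Proof.
move=> ab1; set x := - (a * b).
have -> : b = 1 - a by rewrite -ab1; ring.
have -> : x = - (a * (1 - a)) by rewrite /x -ab1; ring.
set y := - _.
have f0 : fib_sum y 0 = 1 by rewrite /fib_sum big_ord1 bin0 mul1r.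
have f1 : fib_sum y 1 = 1.
  by rewrite /fib_sum big_ord_recl big_ord1 bin0 bin0n mul0r addr0 mul1r.
(* Both sides satisfy u_{n+2} = u_{n+1} + y u_n. *)
suff [] : fib_sum y n.+2 + y * fib_sum y n = a ^+ n.+2 + (1 - a) ^+ n.+2 /\
  fib_sum y n.+3 + y * fib_sum y n.+1 = a ^+ n.+3 + (1 - a) ^+ n.+3 by [].
elim: n => [|n [IH0 IH1]].
  by rewrite !fib_sum_rec f0 f1 /y; split; ring.
split=> //.
have -> : fib_sum y n.+4 + y * fib_sum y n.+2 =
    (fib_sum y n.+3 + y * fib_sum y n.+1) +
    y * (fib_sum y n.+2 + y * fib_sum y n).
  rewrite (fib_sum_rec y n.+2) {2}(fib_sum_rec y n); ring.
rewrite IH0 IH1 /y !exprS; ring.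
Qed.

(** The two binomials in [lucas_coef] are the terms of the two diagonal sums that
    [fib_sum_power_sum] combines. *)
Lemma sum_lucas_coef (R : comNzRingType) (a b : R) (m : nat) : a + b = 1 ->
  \sum_(i < m.+2) (lucas_coef m.+1.*2 i)%:R * (- (a * b)) ^+ i =
  a ^+ m.+1.*2 + b ^+ m.+1.*2.
Proof.
move=> ab1; rewrite doubleS -(fib_sum_power_sum _ ab1).
move: (- (a * b)) => x.
(* For i > p the lower index of 'C(p.*2 - i, i) exceeds the upper one. *)
have trunc p : fib_sum x p.*2 = \sum_(i < p.+1) 'C(p.*2 - i, i)%:R * x ^+ i.
  rewrite /fib_sum -!(big_mkord xpredT (fun i => 'C(p.*2 - i, i)%:R * x ^+ i)).
  rewrite (big_cat_nat (n := p.+1)) /=; [|lia|lia].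
  rewrite [X in _ + X]big_nat [X in _ + X]big1 ?addr0 // => i /andP[pi _].
  by rewrite bin_small ?mul0r //; lia.
rewrite -doubleS !trunc big_ord_recl [in RHS]big_ord_recl -addrA.
congr (_ + _).
rewrite mulr_sumr -big_split /=; apply: eq_bigr => i _.
rewrite /bump /= add1n doubleS !subSS natrD exprS; ring.
Qed.

(** Splits a falling factorial of [2 m] into its even and its odd factors. *)
Lemma ffact_double (m i : nat) :
  (2 ^ i * m ^_ i * \prod_(s < i) (m.*2 - s.*2 - 1) = m.*2 ^_ i.*2)%N.
Proof.
elim: i => [|i IHi]; first by rewrite big_ord0.
rewrite big_ord_recr /= doubleS !ffactnSr expnS -IHi.
have -> : (m.*2 - i.*2 = 2 * (m - i))%N by lia.
have -> : (m.*2 - i.*2.+1 = 2 * (m - i) - 1)%N by lia.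
ring.
Qed.

Lemma rising_fact (p j : nat) : (p`! * \prod_(t < j) (p.+1 + t) = (p + j)`!)%N.
Proof.
elim: j => [|j IHj]; first by rewrite big_ord0 muln1 addn0.
by rewrite big_ord_recr /= mulnA IHj addnS factS mulnC.
Qed.

(** After multiplication by [i! (m - 1)! (2 m - 2 i)!], both sides equal
    [2 ^ i (2 m)! (2 m - i - 1)!]. *)
Lemma path_weight_lucas (m i : nat) : (0 < m)%N -> (i <= m)%N ->
  ('C(m, i) * (\prod_(t < m - i) (m + t) *
               \prod_(s < i) (4 * (m.*2 - s.*2 - 1))) =
   m.*2.-1 ^_ m * (lucas_coef m.*2 i * 2 ^ i))%N.
Proof.
case: m => // p _ ip; set m := p.+1 in ip *.
have luc := @lucas_coef_fact m.*2 i isT ltac:(lia).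
have rise := rising_fact p (m - i).
have odd := ffact_double m i.
have falls := @ffact_fact m.*2 i.*2 ltac:(lia).
have den := @ffact_fact m.*2.-1 m ltac:(lia).
have eden : (m.*2.-1 - m = p)%N by lia.
have erise : (p + (m - i) = (m.*2 - i).-1)%N by lia.
have top : (m.*2)`! = (m.*2 * m.*2.-1`!)%N by rewrite -factS.
rewrite eden in den; rewrite erise in rise.
rewrite -bin_ffact in odd.
rewrite big_split /= prod_nat_const card_ord (expnMn 2 2).
have pos : (0 < i`! * p`! * (m.*2 - i.*2)`!)%N by rewrite !muln_gt0 !fact_gt0.
apply/eqP; rewrite -(eqn_pmul2l pos); apply/eqP.
(* What remains follows from the six product formulas alone, so the factorials
   and powers can be treated as independent variables. *)
move: luc rise odd falls den top.
move: (lucas_coef _ _) (\prod_(t < _) _)%N (\prod_(s < i) _)%N => l A B.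
move: (m.*2.-1 ^_ m)%N (m.*2 ^_ i.*2)%N ('C(m, i)) (2 ^ i)%N => D E C q.
move: (i`!) (p`!) ((m.*2 - i.*2)`!) (((m.*2 - i).-1)`!) => fi fp fr ft.
move: (m.*2) ((m.*2)`!) (m.*2.-1`!) => N g h luc rise odd falls den top.
transitivity (q * g * ft)%N.
  by rewrite -falls -odd -rise; ring.
transitivity (q * (D * fp) * (l * (fi * fr)))%N; last by ring.
by rewrite luc den top; ring.
Qed.

Theorem theorem8 (n : nat) (hn : (0 < n)%N) :
  2 ^+ (2 ^ n)%N + 1 =
    (F n 0%N (2 ^ n.-1)%N)%:~R /
      (\prod_(1 <= j < (2 ^ n.-1)%N.+1) (2 ^+ n - j%:R)) :> rat.
Proof.
set m := (2 ^ n.-1)%N.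
have m0 : (0 < m)%N by rewrite expn_gt0.
have Nm : (2 ^ n = m.*2)%N by rewrite -{1}(prednK hn) expnS mul2n.
have NE (R : nzRingType) : 2 ^+ n = m.*2%:R :> R by rewrite -Nm natrX.
have den : \prod_(1 <= j < m.+1) (2 ^+ n - j%:R) = (m.*2.-1 ^_ m)%:R :> rat.
  rewrite ffact_prod natr_prod big_add1 big_mkord; apply: eq_bigr => j _.
  have : (j < m)%N := ltn_ord j; move: (nat_of_ord j) => {}j jm.
  by rewrite NE -natrB; [congr (_%:R); lia | lia].
have num : F n 0 m = (m.*2.-1 ^_ m)%:R * (2 ^+ m.*2 + 1).
  (* The roots for x = 2 are 2 and -1. *)
  have -> : 2 ^+ m.*2 + 1 = 2 ^+ m.*2 + (-1) ^+ m.*2 :> int.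
    by rewrite -[(-1) ^+ _]signr_odd odd_double.
  rewrite -(prednK m0) -sum_lucas_coef // (prednK m0) F_closed_form mulr_sumr.
  apply: eq_bigr => i _; have im : (i <= m)%N by rewrite -ltnS.
  have -> : - (2 * -1) = 2%:R :> int by [].
  rewrite NE -natrX -!natrM -path_weight_lucas // !natrM !natr_prod.
  congr (_ * (_ * _)); first by apply: eq_bigr => t _; lia.
  by apply: eq_bigr => s _; have := ltn_ord s; lia.
have D0 : (m.*2.-1 ^_ m)%:R != 0 :> rat.
  by rewrite pnatr_eq0 -lt0n ffact_gt0; lia.
by rewrite den num Nm rmorphM rmorph_nat rmorphD rmorphXn /= mulrC mulKf.
Qed.
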